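(* The inclusion $L(\mathbb B_{2,\infty})\subset L(\mathbb B_\infty)$ is irreducible, i.e. $L(\mathbb B_{2,\infty})'\cap L(\mathbb B_\infty)=\mathbb C\mathbf 1$.
   Context: $\mathbb B_\infty$ is the infinite braid group, generated by $\sigma_1,\sigma_2,\dots$ subject to $\sigma_i\sigma_j\sigma_i=\sigma_j\sigma_i\sigma_j$ if $|i-j|=1$ and $\sigma_i\sigma_j=\sigma_j\sigma_i$ if $|i-j|>1$, and $\mathbb B_{2,\infty}=\langle\sigma_k\mid k\ge2\rangle$. $L(\mathbb B_\infty)$ is the group von Neumann algebra generated by the left regular representation $\{L_\sigma:\sigma\in\mathbb B_\infty\}$ on $\ell^2(\mathbb B_\infty)$, and $L(\mathbb B_{2,\infty})$ is the von Neumann subalgebra generated by $\{L_\sigma:\sigma\in\mathbb B_{2,\infty}\}$. *)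

(* Defs.v *)
From HB Require Import structures.
From mathcomp Require Import all_boot all_order all_algebra.
From mathcomp Require Import complex.
From mathcomp Require Import all_classical all_reals.
From mathcomp Require Import ereal esum numfun.
From mathcomp Require Import ring.

Set Implicit Arguments.
Unset Strict Implicit.
Unset Printing Implicit Defensive.

Import Order.TTheory GRing.Theory Num.Theory.
Local Open Scope classical_set_scope.
Local Open Scope ring_scope.

(* The letter [(x, b)] stands for the generator [x] if [b = false] and for its
   formal inverse if [b = true]. *)
Definition word (X : choiceType) := seq (X * bool).

Definition inv_word (X : choiceType) (w : word X) : word X :=
  rev [seq (x.1, ~~ x.2) | x <- w].

Section Presentation.
Variables (X : choiceType) (rels : word X -> word X -> Prop).

Inductive word_equiv : word X -> word X -> Prop :=
| WordRefl u : word_equiv u u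
| WordSym u v : word_equiv u v -> word_equiv v u
| WordTrans u v w : word_equiv u v -> word_equiv v w -> word_equiv u w
| WordCat u u' v v' : word_equiv u u' -> word_equiv v v' ->
    word_equiv (u ++ v) (u' ++ v')
| WordCancel x b : word_equiv [:: (x, b); (x, ~~ b)] [::]
| WordRel u v : rels u v -> word_equiv u v.

Definition word_rel : rel (word X) := fun u v => `[< word_equiv u v >].

Lemma word_rel_refl : reflexive word_rel.
Proof. by move=> u; apply/asboolP; exact: WordRefl. Qed.

Lemma word_rel_sym : symmetric word_rel.
Proof.
by move=> u v; apply/asboolP/asboolP; exact: WordSym.
Qed.

Lemma word_rel_trans : transitive word_rel.
Proof.
by move=> v u w /asboolP uv /asboolP vw; apply/asboolP; exact: WordTrans vw.
Qed.

Canonical word_equiv_rel :=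
  EquivRel word_rel word_rel_refl word_rel_sym word_rel_trans.

Definition presented := {eq_quot word_equiv_rel}%qT.

HB.instance Definition _ := Choice.on presented.
HB.instance Definition _ := EqQuotient.on presented.

Definition cls (w : word X) : presented := (\pi_presented w)%qT.

Lemma clsP u v : cls u = cls v <-> word_equiv u v.
Proof.
split=> [/eqmodP/asboolP //|uv].
by apply/eqmodP/asboolP.
Qed.

Lemma reprP (w : word X) : word_equiv (repr (cls w)) w.
Proof. by apply/clsP; rewrite /cls reprK. Qed.

Lemma inv_wordK : involutive (@inv_word X).
Proof.
move=> w; rewrite /inv_word map_rev revK -map_comp -[RHS]map_id.
by apply: eq_map => -[x b] /=; rewrite negbK.
Qed.

Lemma word_catV w : word_equiv (w ++ inv_word w) [::].
Proof.
elim: w => [|[x b] w IHw]; first exact: WordRefl.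
rewrite /inv_word /= rev_cons -cats1 -cat1s !catA -(catA [:: _]).
apply: (WordTrans _ (WordCancel x b)).
rewrite -[[:: _; _]]/([:: (x, b)] ++ [:: (x, ~~ b)]).
apply: WordCat (WordRefl _).
by rewrite -{2}[[:: _]]cats0; apply: WordCat IHw; exact: WordRefl.
Qed.

Lemma word_Vcat w : word_equiv (inv_word w ++ w) [::].
Proof. by rewrite -{2}[w]inv_wordK; exact: word_catV. Qed.

Lemma inv_word_equiv u v :
  word_equiv u v -> word_equiv (inv_word u) (inv_word v).
Proof.
move=> uv; apply: (WordTrans (v := inv_word u ++ v ++ inv_word v)).
  rewrite -{1}[inv_word u]cats0; apply: WordCat; first exact: WordRefl.
  by apply: WordSym; exact: word_catV.
rewrite catA -[X in word_equiv _ X]cat0s.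
apply: WordCat (WordRefl _); apply: WordTrans (word_Vcat u).
by apply: WordCat; [exact: WordRefl | exact: WordSym].
Qed.

Definition presented_mul (g h : presented) : presented :=
  cls (repr g ++ repr h).
Definition presented_inv (g : presented) : presented := cls (inv_word (repr g)).

Lemma cls_cat u v : presented_mul (cls u) (cls v) = cls (u ++ v).
Proof. by apply/clsP; apply: WordCat; exact: reprP. Qed.

Lemma cls_inv u : presented_inv (cls u) = cls (inv_word u).
Proof. by apply/clsP; apply: inv_word_equiv; exact: reprP. Qed.

Lemma cls_surj (g : presented) : exists w, g = cls w.
Proof. by exists (repr g); rewrite /cls reprK. Qed.

Lemma presented_mulA : associative presented_mul.
Proof.
move=> g h k.
have [[u ->] [v ->] [w ->]] := And3 (cls_surj g) (cls_surj h) (cls_surj k).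
by rewrite !cls_cat catA.
Qed.

Lemma presented_mul1 : left_id (cls [::]) presented_mul.
Proof. by move=> g; have [u ->] := cls_surj g; rewrite cls_cat. Qed.

Lemma presented_mulr1 : right_id (cls [::]) presented_mul.
Proof. by move=> g; have [u ->] := cls_surj g; rewrite cls_cat cats0. Qed.

Lemma presented_mulgV :
  right_inverse (cls [::]) presented_inv presented_mul.
Proof.
move=> g; have [u ->] := cls_surj g; rewrite cls_inv cls_cat.
by apply/clsP; exact: word_catV.
Qed.

Lemma presented_mulVg :
  left_inverse (cls [::]) presented_inv presented_mul.
Proof.
move=> g; have [u ->] := cls_surj g; rewrite cls_inv cls_cat.
by apply/clsP; exact: word_Vcat.
Qed.

HB.instance Definition _ := isGroup.Build presented
  presented_mulA presented_mul1 presented_mulr1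
  presented_mulVg presented_mulgV.

Definition generator (x : X) : presented := cls [:: (x, false)].

End Presentation.

Definition subgroup_generated (G : groupType) (S : set G) : set G :=
  smallest [set H : set G | group_closed [in H]] S.

Definition braid_index := {k : nat | (0 < k)%N}.

Inductive braid_rel : word braid_index -> word braid_index -> Prop :=
| BraidRel (i j : braid_index) :
    (`|(val i)%:Z - (val j)%:Z| = 1)%N ->
    braid_rel [:: (i, false); (j, false); (i, false)]
              [:: (j, false); (i, false); (j, false)]
| BraidComm (i j : braid_index) :
    (1 < `|(val i)%:Z - (val j)%:Z|)%N ->
    braid_rel [:: (i, false); (j, false)] [:: (j, false); (i, false)].

Definition braid_inf := presented braid_rel.
HB.instance Definition _ := Group.on braid_inf.

Definition sigma (k : braid_index) : braid_inf := generator braid_rel k.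

Definition braid_2inf : set braid_inf :=
  subgroup_generated (sigma @` [set k : braid_index | (2 <= val k)%N]).

Section Ell2.
Variables (R : realType) (I : choiceType).
Local Notation C := R[i].
Import Normc.

Definition sqsum (f : I -> C) : \bar R :=
  \esum_(x in [set: I]) (normc (f x) ^+ 2)%:E.

Definition square_summable : {pred I -> C} :=
  fun f => `[< (sqsum f < +oo)%E >].

Lemma normc_sqr (z : C) : normc z ^+ 2 = complex.Re z ^+ 2 + complex.Im z ^+ 2.
Proof. by case: z => a b /=; rewrite sqr_sqrtr // addr_ge0 ?sqr_ge0. Qed.

Lemma square_summable_submod_closed : submod_closed square_summable.
Proof.
split=> [|a f g /asboolP fS /asboolP gS]; apply/asboolP.
  rewrite /sqsum esum1 ?ltry // => x _.
  by rewrite normc_sqr /= expr0n /= addr0.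
pose c : R := 2 * normc a ^+ 2.
have c_ge0 : 0 <= c by rewrite mulr_ge0 ?sqr_ge0.
suff le_fg : (sqsum (a *: f + g)%R <= c%:E * sqsum f + 2%R%:E * sqsum g)%E.
  apply: le_lt_trans le_fg _.
  have sqsum_ge0 h : (0 <= sqsum h)%E.
    by apply: esum_ge0 => x _; rewrite lee_fin sqr_ge0.
  have fin h : (sqsum h < +oo)%E -> sqsum h \is a fin_num.
    by move=> hS; rewrite ge0_fin_numE.
  by rewrite -(fineK (fin _ fS)) -(fineK (fin _ gS)) -!EFinM -EFinD ltry.
apply: ub_ereal_sup => _ [F [finF _] <-].
have le_term x : ((normc ((a *: f + g)%R x) ^+ 2)%:E
    <= c%:E * (normc (f x) ^+ 2)%:E + 2%R%:E * (normc (g x) ^+ 2)%:E)%E.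
  rewrite -!EFinM -EFinD lee_fin /c -mulrA -exprMn -normcM.
  rewrite -[(a *: f + g) x]/(a * f x + g x) !normc_sqr.
  case: (a * f x) (g x) => [p q] [r s] /=.
  rewrite -subr_ge0.
  rewrite [leRHS](_ : _ = (p - r) ^+ 2 + (q - s) ^+ 2).
    by rewrite addr_ge0 ?sqr_ge0.
  by ring.
have esum_ub h : (\sum_(x \in F) (normc (h x) ^+ 2)%:E <= sqsum h)%E.
  by apply: ereal_sup_ubound; exists F.
apply: (@le_trans _ _ (c%:E * (\sum_(x \in F) (normc (f x) ^+ 2)%:E)
    + 2%R%:E * (\sum_(x \in F) (normc (g x) ^+ 2)%:E))%E); last first.
  by apply: leeD; rewrite lee_wpmul2l // lee_fin.
rewrite !fsbig_finite //= !ge0_sume_distrr => [|x _|x _];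
  rewrite ?lee_fin ?sqr_ge0 //.
by rewrite -big_split /=; apply: lee_sum => x _; exact: le_term.
Qed.

HB.instance Definition _ := GRing.isSubmodClosed.Build C (I -> C)
  square_summable square_summable_submod_closed.

Record ell2 := Ell2 {
  ell2_fun :> I -> C;
  ell2P : ell2_fun \in square_summable }.

HB.instance Definition _ := [isSub for ell2_fun].
HB.instance Definition _ := [Choice of ell2 by <:].
HB.instance Definition _ := [SubChoice_isSubLmodule of ell2 by <:].

Definition ell2_norm (xi : ell2) : R := Num.sqrt (fine (sqsum xi)).

(* Sum of an absolutely summable family, through its positive and negative
   parts since [esum] is meant for nonnegative families. *)
Definition rsum (f : I -> R) : R :=
  fine (\esum_(x in [set: I]) (f^\+ x)%:E)
  - fine (\esum_(x in [set: I]) (f^\- x)%:E).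

Definition csum (f : I -> C) : C :=
  Complex (rsum (fun x => complex.Re (f x))) (rsum (fun x => complex.Im (f x))).

Definition inner (xi eta : ell2) : C := csum (fun x => xi x * (eta x)^*).

End Ell2.

Section VonNeumann.
Variables (R : realType) (I : choiceType).
Local Notation C := R[i].
Local Notation H := (ell2 R I).

Definition bounded_operator (T : H -> H) : Prop :=
  linear T /\
  exists M : R, forall xi, ell2_norm (T xi) <= M * ell2_norm xi.

Definition is_adjoint (S T : H -> H) : Prop :=
  forall xi eta, inner (S xi) eta = inner xi (T eta).

(* A basic weak operator neighbourhood of [T] is given by finitely many pairs of vectors
   and a radius. *)
Definition weak_operator_closure (A : set (H -> H)) : set (H -> H) :=
  [set T | bounded_operator T /\
    forall (s : seq (H * H)) (e : R), 0 < e ->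
      exists2 S, A S & forall p, p \in s ->
        Normc.normc (inner (S p.1 - T p.1) p.2) < e].

(* [vna_adjoint] is stated relationally, to avoid constructing adjoints. *)
Record von_neumann_algebra (A : set (H -> H)) : Prop := {
  vna_bounded : A `<=` bounded_operator;
  vna_id : A idfun;
  vna_linear : forall (a : C) S T, A S -> A T -> A (a *: S + T);
  vna_comp : forall S T, A S -> A T -> A (S \o T);
  vna_adjoint : forall S T,
    A S -> bounded_operator T -> is_adjoint S T -> A T;
  vna_closed : weak_operator_closure A `<=` A }.

Definition von_neumann_generated (X : set (H -> H)) : set (H -> H) :=
  smallest von_neumann_algebra X.

Definition commutant (A : set (H -> H)) : set (H -> H) :=
  [set T | bounded_operator T /\ forall S, A S -> S \o T = T \o S].

End VonNeumann.

Section GroupAlgebra.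
Variables (R : realType) (G : groupType).

Lemma left_translate_subproof (g : G) (xi : ell2 R G) :
  (fun h => xi (g^-1 * h)%g) \in @square_summable R G.
Proof.
apply/asboolP; have /asboolP := ell2P xi; apply: le_lt_trans.
rewrite /sqsum [leRHS](@reindex_esum _ _ _ setT setT (fun h : G => g^-1 * h)%g) //.
split=> // [x y _ _ /mulgI //|x _].
by exists (g * x)%g; rewrite // mulKg.
Qed.

Definition left_regular (g : G) (xi : ell2 R G) : ell2 R G :=
  Ell2 (left_translate_subproof g xi).

(* [group_vna R K] is the von Neumann algebra generated by the translations
   by elements of [K]; for [K = setT] it is the group von Neumann algebra of
   [G]. *)
Definition group_vna (K : set G) : set (ell2 R G -> ell2 R G) :=
  von_neumann_generated (left_regular @` K).

End GroupAlgebra.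

Arguments group_vna R {G} K.

(* Main.v *)
Require Import Defs.
From mathcomp Require Import all_boot all_order all_algebra.
From mathcomp Require Import finmap complex.
From mathcomp Require Import all_classical all_reals.
From mathcomp Require Import ereal esum numfun.
From mathcomp Require Import zify ring lra.

(** The proof has a group-theoretic and an operator-algebraic half.

    Operators: let [T] be in the relative commutant and put [xi := T delta_1].
    Elements of the group von Neumann algebra commute with right translations
    ([group_vna_right_invariant]), and [T] commutes with left translations by
    the subgroup, so [xi] is constant on the conjugacy orbits of the subgroup.
    A square summable function vanishes wherever it repeats a value infinitely
    often; hence, if the orbit of every [g != 1] is infinite, [xi] is a multiple
    of [delta_1], and right invariance together with density of the finitely
    supported vectors makes [T] scalar ([relative_icc_irreducible]).

    Group: it remains to see that conjugation by [sigma_2, sigma_3, ...] moves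
    every [g != 1] to infinitely many elements ([braid_conj_infinite]). The tool
    is the operation of deleting one strand. It is not a homomorphism, since the
    position of the deleted strand changes along the braid, but it becomes an
    action of the braid group on pairs (position of the deleted strand, braid
    formed so far by the other strands); as an action it can be defined on
    generators and checked on the braid relations.

    Let [g] be a braid on the first [n + 1] strands and let [h_m] carry a strand
    from position [n + m] to the last of these positions, crossing only strands
    further out. If [h_m g h_m^-1 = h_m' g h_m'^-1] with [m < m'], delete on both
    sides the strand at position [n + m']. On the left it is not involved, so
    nothing changes; on the right what is deleted is the last strand of [g]. So
    [h_m g h_m^-1] is a braid on [n] strands; it commutes with [h_m], so [g]
    itself is a braid on [n] strands ([strands_descend]). Descending on the
    number of strands, a braid with a finite orbit is trivial. Note that [h_m]
    avoids [sigma_1] as long as [n > 0]. *)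

Set Implicit Arguments.
Unset Strict Implicit.
Unset Printing Implicit Defensive.

Import Order.TTheory GRing.Theory Num.Theory.
Local Open Scope classical_set_scope.
Local Open Scope ring_scope.

(** * Deleting a strand from a braid *)

Section Forget.
Local Open Scope nat_scope.
Local Open Scope group_scope.

(** Positions of strands are counted from 0, so that [gen k], which is
    [sigma_(k+1)], exchanges the strands at positions [k] and [k.+1]. *)
Definition cross (k p : nat) : nat :=
  if p == k then k.+1 else if p == k.+1 then k else p.

Definition index_succ (k : nat) : braid_index := exist _ k.+1 (ltn0Sn k).

Definition gen (k : nat) : braid_inf := sigma (index_succ k).

Lemma sigma_gen (i : braid_index) : sigma i = gen (val i).-1.
Proof. by congr sigma; apply: val_inj => /=; case: i => -[]. Qed.

Lemma cls_mul (u v : word braid_index) :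
  cls braid_rel u * cls braid_rel v = cls braid_rel (u ++ v) :> braid_inf.
Proof. exact: cls_cat. Qed.

Lemma cls_letter (l : braid_index * bool) :
  cls braid_rel [:: l] =
    (if l.2 then (sigma l.1)^-1 else sigma l.1) :> braid_inf.
Proof. by case: l => i [] //=; symmetry; exact: cls_inv. Qed.

Lemma gen_braid k : gen k * gen k.+1 * gen k = gen k.+1 * gen k * gen k.+1.
Proof.
rewrite /gen /sigma /generator !(cls_mul [:: _] [:: _]) !(cls_mul (_ ++ _)).
apply/clsP; apply: WordRel.
by have := @BraidRel (index_succ k) (index_succ k.+1); apply=> /=; lia.
Qed.

Lemma gen_comm j k : (j.+1 < k)%N || (k.+1 < j)%N ->
  gen j * gen k = gen k * gen j.
Proof.
move=> jk; rewrite /gen /sigma /generator !cls_mul; apply/clsP; apply: WordRel.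
have := @BraidComm (index_succ j) (index_succ k); apply=> /=; lia.
Qed.

(** The letter [gen k] seen by the strands other than the one at position [p]:
    it disappears if [p] takes part in the crossing, and its index drops if [p]
    lies to the left. *)
Definition residue (k p : nat) : braid_inf :=
  if (p < k)%N then gen k.-1 else if (p <= k.+1)%N then 1 else gen k.

Definition forget_letter (st : nat * braid_inf) (l : braid_index * bool) :=
  let k := (val l.1).-1 in
  (cross k st.1, st.2 * (if l.2 then (residue k st.1)^-1 else residue k st.1)).

Definition forget_word (w : word braid_index) (st : nat * braid_inf) :=
  foldl forget_letter st w.

Ltac decide_ifs :=
  repeat match goal with |- context [if ?b then _ else _] =>
    first [ have -> : b = true by lia | have -> : b = false by lia ] end.

Lemma crossK k : involutive (cross k).
Proof.
move=> p; rewrite /cross.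
have [pk|pk] := eqVneq p k; first by decide_ifs.
by have [pk1|pk1] := eqVneq p k.+1; decide_ifs.
Qed.

Lemma residue_cross k p : residue k (cross k p) = residue k p.
Proof.
rewrite /residue /cross.
have [pk|pk] := eqVneq p k; first by decide_ifs.
by have [pk1|pk1] := eqVneq p k.+1; decide_ifs.
Qed.

(** Deleting one of three strands turns either side of the braid relation into
    the single crossing of the two others, and deleting any other strand leaves
    a braid relation. *)
Lemma residue_braid k p :
  cross k (cross k.+1 (cross k p)) = cross k.+1 (cross k (cross k.+1 p)) /\
  residue k p * residue k.+1 (cross k p) * residue k (cross k.+1 (cross k p)) =
  residue k.+1 p * residue k (cross k.+1 p) *
    residue k.+1 (cross k (cross k.+1 p)).
Proof.
have : [\/ (p < k)%N, p = k, p = k.+1 | p = k.+2 \/ (k.+2 < p)%N].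
  case: (ltngtP p k) => [pk|kp|->]; [by constructor 1| |by constructor 2].
  case: (ltngtP p k.+1) => [pk|{}kp|->]; [lia | |by constructor 3].
  by constructor 4; case: (ltngtP p k.+2) => [|?|->]; [lia | right | left].
case=> [pk|->|->|[->|kp]]; rewrite /cross /residue; decide_ifs;
  rewrite ?mul1g ?mulg1; split=> //; last exact: gen_braid.
case: k pk => // k _; exact: gen_braid.
Qed.

Lemma residue_comm j k p : (j.+1 < k)%N ->
  cross j (cross k p) = cross k (cross j p) /\
  residue j p * residue k (cross j p) = residue k p * residue j (cross k p).
Proof.
move=> jk; split.
  rewrite /cross; have [pj|pj] := eqVneq p j; first by decide_ifs.
  have [pj1|pj1] := eqVneq p j.+1; first by decide_ifs.
  have [pk|pk] := eqVneq p k; first by decide_ifs.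
  by have [pk1|pk1] := eqVneq p k.+1; decide_ifs.
have -> : residue k (cross j p) = residue k p.
  rewrite /residue /cross; have [pj|pj] := eqVneq p j; first by decide_ifs.
  by have [pj1|pj1] := eqVneq p j.+1; first by decide_ifs.
have -> : residue j (cross k p) = residue j p.
  rewrite /residue /cross; have [pk|pk] := eqVneq p k; first by decide_ifs.
  by have [pk1|pk1] := eqVneq p k.+1; first by decide_ifs.
rewrite /residue; case: (ltnP p j) => pj.
  by decide_ifs; apply: gen_comm; lia.
case: (leqP p j.+1) => pj1; first by decide_ifs; rewrite mul1g mulg1.
case: (ltnP p k) => pk; first by apply: gen_comm; lia.
case: (leqP p k.+1) => pk1; first by decide_ifs; rewrite mul1g mulg1.
by apply: gen_comm; lia.
Qed.

(** This is what makes the deletion of a strand an operation on braids and not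
    only on words. *)
Lemma forget_word_equiv u v : word_equiv braid_rel u v ->
  forget_word u =1 forget_word v.
Proof.
elim=> {u v} [//|u v _ IH st|u v w _ IH1 _ IH2 st|u u' v v' _ IH1 _ IH2 st
  |i b [p x]|u v [] i j + [p x]].
- by rewrite IH.
- by rewrite IH1.
- rewrite /forget_word !foldl_cat.
  by rewrite -/(forget_word u st) -/(forget_word u' st) IH1; exact: IH2.
- rewrite /forget_word /= /forget_letter /= residue_cross crossK -mulgA.
  by case: b; rewrite /= ?mulVg ?mulgV mulg1.
- rewrite /forget_word /= /forget_letter /=.
  case: i j => [[//|i'] _] [[//|j'] _] /= ij.
  have {ij} : (j' = i'.+1) \/ (i' = j'.+1) by lia.
  (* The relation is symmetric in its two sides. *)
  wlog: i' j' / j' = i'.+1.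
    by move=> H [E|E]; [|symmetry]; apply: H => //; left.
  move=> -> _ {j'}; have [-> r] := residue_braid i' p.
  by congr pair; rewrite -!mulgA; congr (_ * _); rewrite !mulgA.
- rewrite /forget_word /= /forget_letter /=.
  case: i j => [[//|i'] _] [[//|j'] _] /= ij.
  have {ij} : (i'.+1 < j')%N \/ (j'.+1 < i')%N by lia.
  wlog: i' j' / (i'.+1 < j')%N.
    by move=> H [E|E]; [|symmetry]; apply: H => //; left.
  move=> ij _; have [-> r] := residue_comm p ij.
  by rewrite -!mulgA r.
Qed.

Definition forget (g : braid_inf) : nat * braid_inf -> nat * braid_inf :=
  forget_word (repr g).

Lemma forget_cls w : forget (cls braid_rel w) =1 forget_word w.
Proof. by apply: forget_word_equiv; exact: reprP. Qed.

Lemma forget1 st : forget 1 st = st.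
Proof. exact: (forget_cls [::]). Qed.

Lemma forgetM g h st : forget (g * h) st = forget h (forget g st).
Proof.
have [[u ->] [v ->]] := (cls_surj g, cls_surj h).
by rewrite cls_mul !forget_cls /forget_word foldl_cat.
Qed.

Lemma forget_gen k p x :
  forget (gen k) (p, x) = (cross k p, x * residue k p).
Proof. by rewrite forget_cls. Qed.

Definition strands (n : nat) : set braid_inf :=
  [set g | exists2 w, g = cls braid_rel w & all (fun l => val l.1 < n)%N w].

Lemma strands_mul n g h : strands n g -> strands n h -> strands n (g * h).
Proof.
move=> [u -> un] [v -> vn]; exists (u ++ v); first exact: cls_mul.
by rewrite all_cat un.
Qed.

Lemma strands_letter n k (b : bool) : (k.+1 < n)%N ->
  strands n (if b then (gen k)^-1 else gen k).
Proof.
move=> kn; exists [:: (index_succ k, b)] => /=.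
  by rewrite cls_letter.
by rewrite kn.
Qed.

Lemma strands1 n : strands n 1.
Proof. by exists [::]. Qed.

Lemma strands_trivial g : strands 1 g -> g = 1.
Proof.
by case=> -[|[[[//|i] i0] b] w] -> //= /andP[].
Qed.

Lemma strands_exists g : exists n, strands n g.
Proof.
have [w ->] := cls_surj g; exists (\max_(l <- w) val l.1).+1, w => //.
by apply/allP => l lw; rewrite ltnS; exact: leq_bigmax_seq.
Qed.

(** The crossings of the first [n.+1] positions keep the deleted strand among
    them, so the other [n] strands are only braided with each other. *)
Lemma forget_last n g x : strands n.+1 g ->
  exists q y, [/\ strands n y & forget g (n, x) = (q, x * y)].
Proof.
move=> [w -> wn].
(* Along the word the deleted strand may be at any position up to [n]. *)
suff H p : (p <= n)%N -> exists q y,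
    strands n y /\ forget_word w (p, x) = (q, x * y).
  by have [q [y [ny E]]] := H n (leqnn n); exists q, y; rewrite forget_cls.
elim: w p x wn => [|[[[//|k] i0] b] w IH] p x /=.
  by move=> _ pn; exists p, 1; split; [exact: strands1 | rewrite mulg1].
case/andP; rewrite ltnS => kn wn pn.
have qn : (cross k p <= n)%N by rewrite /cross; do 2!case: eqP => ? //; lia.
rewrite /forget_letter /=; set r := (if b then _ else _).
have [q [y [ny ->]]] := IH _ (x * r) wn qn.
exists q, (r * y); split; last by rewrite mulgA.
apply: strands_mul ny.
rewrite /r /residue; case: (ltnP p k) => pk.
  by apply: strands_letter; lia.
case: (leqP p k.+1) => pk1; last by apply: strands_letter; lia.
by case: (b); rewrite ?invg1; exact: strands1.
Qed.

Lemma forget_above n p g x : strands n g -> (n <= p)%N ->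
  forget g (p, x) = (p, x * g).
Proof.
move=> [w -> wn] np; rewrite forget_cls.
elim: w x wn => [|l w IH] x /=; first by rewrite mulg1.
case/andP=> ln wn; rewrite -cat1s -cls_mul mulgA -IH //; congr forget_word.
rewrite /forget_letter /= cls_letter sigma_gen.
have l0 := valP l.1; rewrite /cross /residue.
by case: l l0 ln => -[k k0] b /= _ ln; decide_ifs.
Qed.

Lemma gen_commute n k g : strands n g -> (n <= k)%N -> gen k * g = g * gen k.
Proof.
move=> [w -> wn] nk; elim: w wn => [|[[[//|j] j0] b] w IH] /=.
  by rewrite mulg1 mul1g.
case/andP=> ln wn; rewrite -cat1s -cls_mul -mulgA -IH // !mulgA; congr (_ * _).
rewrite cls_letter sigma_gen /=.
have C : gen k * gen j = gen j * gen k by apply: gen_comm; lia.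
case: b => //; apply: (mulgI (gen j)).
by rewrite !mulgA mulgV mul1g -C -mulgA mulgV mulg1.
Qed.

(** * Infinite conjugacy orbits *)

(** As a right action on positions, [carry n m] brings the strand at position
    [n + m] to position [n] and shifts those in between outwards. *)
Fixpoint carry (n m : nat) : braid_inf :=
  if m is m'.+1 then gen (n + m') * carry n m' else 1.

Lemma strands_carry n m : strands (n + m).+1 (carry n m).
Proof.
elim: m => [|m IH] /=; first exact: strands1.
apply: strands_mul; first by apply: (@strands_letter _ _ false); lia.
by case: IH => w -> wn; exists w => //; apply: sub_all wn => l; lia.
Qed.

Lemma forget_carry n m x : forget (carry n m) (n + m, x)%N = (n, x).
Proof.
elim: m x => [|m IH] x /=; first by rewrite addn0 forget1.
rewrite forgetM forget_gen -[in RHS](IH x); congr forget.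
by rewrite /cross /residue; decide_ifs; rewrite mulg1.
Qed.

Lemma carry_commute n m g : strands n g -> carry n m * g = g * carry n m.
Proof.
move=> ng; elim: m => [|m IH] /=; first by rewrite mul1g mulg1.
by rewrite -mulgA IH !mulgA (gen_commute ng) // leq_addr.
Qed.

Lemma carry_braid_2inf n m : (0 < n)%N -> braid_2inf (carry n m).
Proof.
move=> n0 H [Hg sH]; elim: m => [|m IH] /=.
  by have [H1 _] := Hg; move: H1; rewrite inE.
have := group_closedM Hg (x := gen (n + m)) (y := carry n m).
rewrite !inE; apply=> //; apply: sH; exists (index_succ (n + m)) => //=; lia.
Qed.

(** Deleting the strand at position [n + m'] leaves the left-hand conjugate
    unchanged, while in the right-hand one it deletes the last strand of [g]. *)
Lemma strands_descend n m m' g : (m < m')%N -> strands n.+1 g ->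
  carry n m * g / carry n m = carry n m' * g / carry n m' -> strands n g.
Proof.
move=> mm' ng; set u := LHS => E.
have nmm' : ((n + m).+1 <= n + m')%N by lia.
have ng' : strands (n + m).+1 g.
  by case: ng => w -> wn; exists w => //; apply: sub_all wn => l; lia.
have hm := forget_above _ (strands_carry n m) nmm'.
have Eu : u * carry n m' = carry n m' * g by rewrite E mulgVK.
have Eu' : u * carry n m = carry n m * g by rewrite /u mulgVK.
(* The strand is not involved in the conjugate by [carry n m]. *)
have fu : forget u ((n + m')%N, 1) = ((n + m')%N, u).
  rewrite /u !forgetM hm mul1g (forget_above _ ng' nmm') -Eu' -hm.
  by rewrite -forgetM mulgV forget1 mulgK.
have [q [y [ny Ey]]] := forget_last 1 ng.
(* The other conjugate first brings this strand to the last position of [g]. *)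
have : (n, u) = (q, y).
  rewrite -[RHS]/(q, y) -[y in RHS]mul1g -Ey.
  by rewrite -(forget_carry n m' u) -fu -forgetM Eu forgetM forget_carry.
case=> _ uy; suff -> : g = y by [].
(* [u] is now a braid on [n] strands, which commutes with [carry n m]. *)
apply: (mulgI (carry n m)); rewrite -Eu' uy.
by rewrite carry_commute.
Qed.
Lemma braid_conj_infinite g : g != 1 ->
  exists2 h : nat -> braid_inf, forall m, braid_2inf (h m) &
    injective (fun m => h m * g / h m).
Proof.
move=> g1; have [n] := strands_exists g; elim: n => [|n IH] ng.
  case/eqP: g1; apply: strands_trivial.
  by case: ng => -[|[]] // -> _; exact: strands1.
case: n => [|n] in IH ng *; first by case/eqP: g1; exact: strands_trivial.
pose orb m := carry n.+1 m * g / carry n.+1 m.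
have [inj|ninj] := pselect (injective orb).
  by exists (carry n.+1) => // m; exact: carry_braid_2inf.
apply: IH; apply: contrapT => nng; apply: ninj => m m' E.
case: (ltngtP m m') => // mm'; case: nng.
  exact: strands_descend mm' ng E.
exact: strands_descend mm' ng (esym E).
Qed.
End Forget.

(** * Bounded operators on square summable families *)

Section HilbertSpace.
Variables (R : realType) (I : choiceType).
Local Notation C := R[i].
Local Notation H := (ell2 R I).
Import Normc.

Definition sqnorm (xi : H) : R := fine (sqsum xi).

Lemma sqsum_sqnorm (xi : H) : sqsum xi = (sqnorm xi)%:E.
Proof.
rewrite fineK // ge0_fin_numE; first exact/asboolP/(ell2P xi).
by apply: esum_ge0 => x _; rewrite lee_fin sqr_ge0.
Qed.

Lemma sum_le_sqnorm (s : seq I) (xi : H) : uniq s ->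
  \sum_(x <- s) normc (xi x) ^+ 2 <= sqnorm xi.
Proof.
move=> us; rewrite -lee_fin -sqsum_sqnorm -sumEFin; apply: esum_ge.
exists [set` s]; first by split=> //; exact: finite_seq.
by rewrite fsbig_seq.
Qed.

Lemma sqnorm_le (xi : H) (b : R) :
  (forall s : seq I, uniq s -> \sum_(x <- s) normc (xi x) ^+ 2 <= b) ->
  sqnorm xi <= b.
Proof.
move=> le_b; rewrite -lee_fin -sqsum_sqnorm.
apply: ge_ereal_sup => _ [F [finF _] <-].
by rewrite fsbig_finite //= sumEFin lee_fin; apply: le_b; exact: fset_uniq.
Qed.

Lemma sqnorm_ge0 (xi : H) : 0 <= sqnorm xi.
Proof. by have := @sum_le_sqnorm [::] xi isT; rewrite big_nil. Qed.

Lemma coord_le_sqnorm (xi : H) x : normc (xi x) ^+ 2 <= sqnorm xi.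
Proof. by have := @sum_le_sqnorm [:: x] xi isT; rewrite big_seq1. Qed.

Lemma normc_sqr_lin (a z w : C) :
  normc (a * z + w) ^+ 2 <= 2 * normc a ^+ 2 * normc z ^+ 2 + 2 * normc w ^+ 2.
Proof.
rewrite -mulrA -exprMn -normcM; move: (a * z) => {a}z.
rewrite !normc_sqr; case: z w => [p q] [r s] /=; rewrite -subr_ge0.
rewrite [leRHS](_ : _ = (p - r) ^+ 2 + (q - s) ^+ 2); last by ring.
by rewrite addr_ge0 ?sqr_ge0.
Qed.

Lemma sqnorm_lin (a : C) (xi eta : H) :
  sqnorm (a *: xi + eta) <= 2 * normc a ^+ 2 * sqnorm xi + 2 * sqnorm eta.
Proof.
apply: sqnorm_le => s us.
apply: (@le_trans _ _ (\sum_(x <- s)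
    (2 * normc a ^+ 2 * normc (xi x) ^+ 2 + 2 * normc (eta x) ^+ 2))).
  by apply: ler_sum => x _; exact: normc_sqr_lin.
rewrite big_split /= -!mulr_sumr; apply: lerD; apply: ler_wpM2l => //;
  by rewrite ?sum_le_sqnorm // mulr_ge0 ?sqr_ge0.
Qed.

(** Unlike the norm, its square is a supremum of finite partial sums, so bounds
    on it can be checked coordinatewise. *)
Lemma bounded_sqnormP (T : H -> H) : bounded_operator T <->
  linear T /\ exists2 K, 0 < K & forall xi, sqnorm (T xi) <= K * sqnorm xi.
Proof.
split=> -[linT].
  case=> M TM; split=> //.
  (* [M] may vanish or be negative; the 1 makes the new bound positive. *)
  exists (M ^+ 2 + 1) => [|xi].
    by have := sqr_ge0 M; lra.
  have := TM xi; rewrite /ell2_norm -!/(sqnorm _) => le_M.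
  apply: (@le_trans _ _ (M ^+ 2 * sqnorm xi)); last first.
    by rewrite mulrDl mul1r lerDl sqnorm_ge0.
  rewrite -[X in X <= _]sqr_sqrtr ?sqnorm_ge0 //.
  rewrite -[X in _ <= _ * X]sqr_sqrtr ?sqnorm_ge0 // -exprMn.
  by apply: lerXn2r; rewrite ?nnegrE ?sqrtr_ge0 //; apply: le_trans le_M.
case=> K K0 TK; split=> //; exists (Num.sqrt K) => xi.
rewrite /ell2_norm -!/(sqnorm _) -sqrtrM ?(ltW K0) //.
by rewrite ler_wsqrtr.
Qed.

Lemma bounded_id : bounded_operator (idfun : H -> H).
Proof. by split=> //; exists 1 => xi; rewrite mul1r. Qed.

Lemma bounded_lin (a : C) (S T : H -> H) :
  bounded_operator S -> bounded_operator T -> bounded_operator (a *: S + T).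
Proof.
move=> /bounded_sqnormP[linS [K K0 SK]] /bounded_sqnormP[linT [L L0 TL]].
apply/bounded_sqnormP; split=> [b u v|].
  have E zeta : (a *: S + T) zeta = a *: S zeta + T zeta by [].
  rewrite !E linS linT !scalerDr !scalerA (mulrC b).
  by rewrite addrACA.
have a2 := sqr_ge0 (normc a).
exists (2 * normc a ^+ 2 * K + 2 * L) => [|xi].
  by rewrite ltr_wpDl ?mulr_gt0 // mulr_ge0 ?(ltW K0) // mulr_ge0.
apply: le_trans (sqnorm_lin _ _ _) _.
rewrite [leRHS]mulrDl; apply: lerD; rewrite -[leRHS]mulrA; apply: ler_wpM2l.
- by rewrite mulr_ge0.
- exact: SK.
- by [].
- exact: TL.
Qed.

Lemma bounded_comp (S T : H -> H) :
  bounded_operator S -> bounded_operator T -> bounded_operator (S \o T).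
Proof.
move=> /bounded_sqnormP[linS [K K0 SK]] /bounded_sqnormP[linT [L L0 TL]].
apply/bounded_sqnormP; split=> [b u v /=|]; first by rewrite linT linS.
exists (K * L) => [|xi /=]; first exact: mulr_gt0.
by apply: le_trans (SK _) _; rewrite -mulrA ler_wpM2l // ltW.
Qed.

Lemma delta_subproof (x : I) :
  (fun y => (y == x)%:R : C) \in @square_summable R I.
Proof.
apply/asboolP; rewrite /sqsum.
rewrite (eq_esum (b := fun y => if y \in [set x] then 1%:E else 0%E)).
  by rewrite -esum_mkcond esum_set1 ?lee_fin // ltry.
move=> y _; rewrite in_set1 normc_sqr.
by case: eqP => _ /=; rewrite ?expr1n expr0n ?addr0.
Qed.

Definition delta (x : I) : H := Ell2 (delta_subproof x).

Lemma ell2_ext (xi eta : H) : xi =1 eta -> xi = eta.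
Proof. by move=> E; apply/val_inj/funext. Qed.

Lemma rsum_single (f : I -> R) x : (forall y, y != x -> f y = 0) ->
  rsum f = f x.
Proof.
move=> f0.
have single (g : I -> R) : (forall y, 0 <= g y) ->
      (forall y, y != x -> g y = 0) ->
    fine (\esum_(y in [set: I]) (g y)%:E) = g x.
  move=> g_ge0 g0.
  rewrite (eq_esum (b := fun y => if y \in [set x] then (g y)%:E else 0%E)).
    by rewrite -esum_mkcond esum_set1 ?lee_fin.
  by move=> y _; rewrite in_set1; case: eqVneq => // /g0 ->.
rewrite /rsum !single //.
- by rewrite -[in RHS](funrposBneg f).
- by move=> y /f0 fy; rewrite /funrneg fy oppr0 maxxx.
- by move=> y /f0 fy; rewrite /funrpos fy maxxx.
Qed.

Lemma csum_single (f : I -> C) x : (forall y, y != x -> f y = 0) ->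
  csum f = f x.
Proof.
move=> f0; rewrite /csum !(@rsum_single _ x) => [|y /f0 ->|y /f0 ->] //.
by case: (f x).
Qed.

Lemma inner_delta (xi : H) x : inner xi (delta x) = xi x.
Proof.
rewrite /inner (@csum_single _ x) /= ?eqxx ?conjC1 ?mulr1 // => y /negbTE ->.
by rewrite conjC0 mulr0.
Qed.

Lemma delta_inner (xi : H) x : inner (delta x) xi = (xi x)^*.
Proof.
rewrite /inner (@csum_single _ x) /= ?eqxx ?mul1r // => y /negbTE ->.
by rewrite mul0r.
Qed.

(** Quantitative density of the finitely supported vectors: the error of a
    truncation is what the partial sum misses of the squared norm. *)
Lemma sqnorm_truncate (s : seq I) (eta : H) : uniq s ->
  sqnorm (eta - \sum_(x <- s) eta x *: delta x)
    <= sqnorm eta - \sum_(x <- s) normc (eta x) ^+ 2.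
Proof.
move=> us; set zeta := eta - _.
have zetaE y : zeta y = if y \in s then 0 else eta y.
  have -> : zeta y = eta y - \sum_(x <- s) eta x * (y == x)%:R.
    have valsum (r : seq I) :
        (\sum_(x <- r) eta x *: delta x) y = \sum_(x <- r) eta x * (y == x)%:R.
      by elim: r => [|x r IH]; rewrite ?big_nil ?big_cons // -IH.
    by rewrite -valsum.
  case: ifPn => ys.
    rewrite (bigD1_seq y) //= eqxx mulr1 big1 ?addr0 ?subrr // => x xy.
    by rewrite eq_sym (negbTE xy) mulr0.
  rewrite big_seq big1 ?subr0 // => x xs.
  rewrite (_ : y == x = false) ?mulr0 //.
  by apply/eqP => yx; rewrite yx xs in ys.
apply: sqnorm_le => t ut; rewrite lerBrDr.
pose t' := [seq y <- t | y \notin s].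
have -> : \sum_(y <- t) normc (zeta y) ^+ 2 = \sum_(y <- t') normc (eta y) ^+ 2.
  rewrite big_filter [RHS]big_mkcond; apply: eq_bigr => y _.
  rewrite zetaE; case: (y \in s) => //.
  by rewrite normc_sqr /= expr0n addr0.
rewrite -big_cat /=; apply: sum_le_sqnorm.
rewrite cat_uniq us filter_uniq //= andbT; apply/hasPn => y ys.
by rewrite mem_filter ys.
Qed.

(** The difference [D] kills every finitely supported vector, so a coordinate of
    [D eta] is controlled by any tail of [eta]. If it were not zero, the partial
    sums of [eta] would stay away from their supremum. *)
Lemma bounded_eq_delta (S T : H -> H) :
  bounded_operator S -> bounded_operator T ->
  (forall x, S (delta x) = T (delta x)) -> S = T.
Proof.
move=> bS bT ST.
have /bounded_sqnormP[linD [K K0 DK]] := bounded_lin (-1) bS bT.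
set D := -1 *: S + T in linD DK.
have Dlin a u v : D (a *: u + v) = a *: D u + D v := linD a u v.
have D0 : D 0 = 0.
  by have := Dlin (-1) 0 0; rewrite scaler0 addr0 scaleN1r addNr.
have DE xi : D xi = -1 *: S xi + T xi by [].
have Ddelta x : D (delta x) = 0 by rewrite DE ST scaleN1r addNr.
have Dsum (r : seq I) (c : I -> C) : D (\sum_(x <- r) c x *: delta x) = 0.
  elim: r => [|x r IH]; first by rewrite big_nil D0.
  by rewrite big_cons Dlin IH Ddelta scaler0 addr0.
apply/funext => eta; apply: ell2_ext => y.
suff Dy : normc (D eta y) ^+ 2 <= 0.
  have {}Dy : D eta y = 0.
    by apply: eq0_normc; apply/eqP; rewrite -sqrf_eq0 eq_le Dy sqr_ge0.
  have : - 1 * S eta y + T eta y = 0 := Dy.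
  by move/eqP; rewrite mulN1r addrC subr_eq0 => /eqP.
have le_s s : uniq s ->
    \sum_(x <- s) normc (eta x) ^+ 2 <= sqnorm eta - normc (D eta y) ^+ 2 / K.
  move=> us; rewrite lerBrDr -lerBrDl ler_pdivrMr // mulrC.
  have -> : D eta = D (eta - \sum_(x <- s) eta x *: delta x).
    by rewrite addrC -scaleN1r Dlin Dsum scaler0 add0r.
  apply: le_trans (coord_le_sqnorm _ _) _; apply: le_trans (DK _) _.
  by apply: ler_wpM2l; [exact: ltW | exact: sqnorm_truncate].
have := sqnorm_le le_s; rewrite lerBrDr gerDl.
by rewrite pmulr_lle0 // invr_gt0.
Qed.
End HilbertSpace.

(** * Relative commutants in group von Neumann algebras *)

Section RegularRepresentation.
Variables (R : realType) (G : groupType).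
Local Notation C := R[i].
Local Notation H := (ell2 R G).
Import Normc.

Lemma translate_bij (g : G) : set_bij setT setT (fun h : G => h * g)%g.
Proof.
split=> // [x y _ _ /mulIg //|x _].
by exists (x / g)%g; rewrite // mulgVK.
Qed.

Lemma right_translate_subproof (g : G) (xi : H) :
  (fun h => xi (h * g)%g) \in @square_summable R G.
Proof.
apply/asboolP; have /asboolP := ell2P xi; apply: le_lt_trans.
by rewrite /sqsum [leRHS](reindex_esum _ _ _ _ (translate_bij g)).
Qed.

Definition right_regular (g : G) (xi : H) : H :=
  Ell2 (right_translate_subproof g xi).

Lemma right_regular_delta (g x : G) :
  right_regular g (delta R x) = delta R (x / g)%g.
Proof.
by apply: ell2_ext => y; rewrite /= (can2_eq (mulgK g) (mulgVK g)).
Qed.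

Lemma left_regular_delta (g x : G) :
  left_regular g (delta R x) = delta R (g * x)%g.
Proof.
by apply: ell2_ext => y; rewrite /= (can2_eq (mulVKg g) (mulKg g)).
Qed.

Lemma right_regularK g (xi : H) : right_regular g (right_regular g^-1 xi) = xi.
Proof. by apply: ell2_ext => y /=; rewrite mulgK. Qed.

Lemma inner_right_regular g (xi eta : H) :
  inner (right_regular g xi) (right_regular g eta) = inner xi eta.
Proof.
have rsum_translate (f : G -> R) : rsum (fun h => f (h * g)%g) = rsum f.
  by rewrite /rsum; congr (fine _ - fine _);
    rewrite [RHS](reindex_esum _ _ _ _ (translate_bij g)).
by rewrite /inner /csum; congr Complex;
  rewrite [RHS](esym (rsum_translate _)).
Qed.

Lemma left_regular_bounded g : bounded_operator (@left_regular R G g).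
Proof.
split=> [a u v|]; first exact: ell2_ext.
exists 1 => xi; rewrite mul1r /ell2_norm le_eqVlt; apply/orP; left; apply/eqP.
congr (Num.sqrt (fine _)); rewrite /sqsum.
rewrite [RHS](@reindex_esum _ _ _ setT setT (fun h : G => g^-1 * h)%g) //.
split=> // [x y _ _ /mulgI //|x _].
by exists (g * x)%g; rewrite // mulKg.
Qed.

Definition right_invariant : set (H -> H) :=
  [set T | bounded_operator T /\
    forall g xi, T (right_regular g xi) = right_regular g (T xi)].

(** Coordinates are inner products with the vectors [delta x]; through them
    right invariance passes to adjoints and to weak limits. *)
Lemma right_invariant_vna : von_neumann_algebra right_invariant.
Proof.
split.
- by move=> T [].
- by split=> //; exact: bounded_id.
- move=> a S T [bS SR] [bT TR]; split=> [|g xi]; first exact: bounded_lin.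
  have E zeta : (a *: S + T) zeta = a *: S zeta + T zeta by [].
  by rewrite !E SR TR; exact: ell2_ext.
- move=> S T [bS SR] [bT TR]; split=> [|g xi]; first exact: bounded_comp.
  by rewrite /= TR SR.
- move=> S T [bS SR] bT ST; split=> // g xi.
  suff E zeta : inner zeta (T (right_regular g xi)) =
      inner zeta (right_regular g (T xi)).
    apply: ell2_ext => x; apply: (can_inj conjCK).
    by rewrite -!delta_inner E.
  rewrite -ST -[zeta](right_regularK g) inner_right_regular -ST SR.
  by rewrite inner_right_regular.
- move=> T [bT clT]; split=> // g xi; apply: ell2_ext => x /=.
  apply/eqP; rewrite -subr_eq0; apply/eqP/eq0_normc/eqP.
  rewrite eq_le; apply/andP; split; last first.
    by case: (X in normc X) => ? ?; exact: sqrtr_ge0.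
  apply/ler_addgt0Pr => e e0; rewrite add0r.
  have e2 : 0 < e / 2 by rewrite divr_gt0.
  (* The two coordinates that right invariance equates, approximated at once. *)
  have [S [bS SR] near_T] := clT
    [:: (right_regular g xi, delta R x); (xi, delta R (x * g)%g)] _ e2.
  have := near_T (right_regular g xi, delta R x) (mem_head _ _).
  have := near_T (xi, delta R (x * g)%g).
  rewrite mem_seq2 eqxx orbT => /(_ isT); rewrite !inner_delta SR.
  set s := S xi (x * g)%g; set t := T xi (x * g)%g; set u := T _ x.
  have -> : (S xi - T xi) (x * g)%g = s - t by [].
  have -> : (right_regular g (S xi) - T (right_regular g xi)) x = s - u by [].
  move=> lt1 lt2; have -> : u - t = (s - t) + - (s - u) by ring.
  apply: le_trans (le_normcD _ _) _; rewrite normcN; lra.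
Qed.

(** Left and right translations commute, and the right invariant operators form
    a von Neumann algebra. *)
Lemma group_vna_right_invariant (K : set G) :
  group_vna R K `<=` right_invariant.
Proof.
apply: smallest_sub; first exact: right_invariant_vna.
move=> _ [g _ <-]; split=> [|h xi]; first exact: left_regular_bounded.
by apply: ell2_ext => y /=; rewrite mulgA.
Qed.

Lemma left_regular_group_vna (K : set G) g :
  K g -> group_vna R K (@left_regular R G g).
Proof. by move=> Kg; apply: sub_gen_smallest; exists g. Qed.

Lemma scalar_group_vna (K : set G) (a : C) :
  group_vna R K (a *: (idfun : H -> H)).
Proof.
move=> A [vA _]; have id_A := vna_id vA.
have := vna_linear vA a id_A (vna_linear vA (-1) id_A id_A).
by rewrite scaleN1r addNr addr0.
Qed.

Lemma scalar_commutant (K : set G) (a : C) :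
  commutant (group_vna R K) (a *: (idfun : H -> H)).
Proof.
split.
  by have [] := group_vna_right_invariant (scalar_group_vna (K := K) a).
move=> S /group_vna_right_invariant[[linS _] _].
apply/funext => xi.
have E (zeta : H) : (a *: (idfun : H -> H)) zeta = a *: zeta by [].
have S0 : S 0 = 0.
  by have := linS (-1) 0 0; rewrite scaler0 addr0 scaleN1r addNr.
by rewrite /= !E -[a *: xi]addr0 linS S0 addr0.
Qed.

Lemma coord_infinite_level (xi : H) (u : nat -> G) (c : C) :
  injective u -> (forall m, xi (u m) = c) -> c = 0.
Proof.
move=> inj_u xi_u; apply: eq0_normc; apply/eqP; rewrite -sqrf_eq0.
apply: contraT => c0.
have {}c0 : 0 < normc c ^+ 2 by rewrite lt_neqAle eq_sym c0 sqr_ge0.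
have le_N (N : nat) : N%:R * normc c ^+ 2 <= sqnorm xi.
  have us : uniq [seq u m | m <- iota 0 N] by rewrite map_inj_uniq ?iota_uniq.
  have := sum_le_sqnorm xi us; rewrite big_map.
  under eq_bigr => m _ do rewrite xi_u.
  by rewrite big_const_seq count_predT size_iota iter_addr_0 mulr_natl.
have := archi_boundP (divr_ge0 (sqnorm_ge0 xi) (ltW c0)).
by rewrite ltr_pdivrMr // ltNge le_N.
Qed.

(** The relative version of the criterion that an ICC group has a factor as its
    von Neumann algebra. The infinite orbits are given by a sequence of elements
    of [K] with distinct conjugates of [g]. *)
Theorem relative_icc_irreducible (K : set G) :
  (forall g : G, g != 1%g ->
    exists2 h : nat -> G, forall m, K (h m) &
      injective (fun m => h m * g / h m)%g) ->
  commutant (group_vna R K) `&` group_vna R [set: G] =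
  [set a *: (idfun : H -> H) | a in [set: C]].
Proof.
move=> icc; apply/seteqP; split=> [T|_ [a _ <-]]; last first.
  by split; [exact: scalar_commutant | exact: scalar_group_vna].
case=> -[bT commT] /group_vna_right_invariant[_ TR].
pose xi := T (delta R 1%g).
have xi_conj h g : K h -> xi (h * g / h)%g = xi g.
  move=> Kh; have TL : left_regular h \o T = T \o @left_regular R G h.
    by apply: commT; exact: left_regular_group_vna.
  (* [delta_h] is both a left and a right translate of [delta_1]. *)
  have E : left_regular h xi = right_regular h^-1%g xi.
    rewrite /xi -TR right_regular_delta invgK mul1g.
    have /= -> := congr1 (@^~ (delta R 1%g)) TL.
    by rewrite left_regular_delta mulg1.
  have := congr1 (fun f : H => f (h * g)%g) E.
  by rewrite /= mulKg => ->.
have xi0 g : g != 1%g -> xi g = 0.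
  move=> /icc[h Kh inj_h]; apply: (coord_infinite_level inj_h) => m.
  exact: xi_conj.
exists (xi 1%g) => //; apply/esym; apply: bounded_eq_delta => // [|x].
  have [] := group_vna_right_invariant (scalar_group_vna (K := setT) (xi 1%g)).
  by [].
have -> : delta R x = right_regular x^-1%g (delta R 1%g).
  by rewrite right_regular_delta invgK mul1g.
rewrite TR -/xi; apply: ell2_ext => y.
change (xi (y / x)%g = xi 1%g * (y / x == 1)%g%:R).
have [->|yx] := eqVneq (y / x)%g 1%g; first by rewrite mulr1.
by rewrite mulr0 xi0.
Qed.
End RegularRepresentation.

Theorem theorem5p2 (R : realType) :
  commutant (group_vna R braid_2inf) `&` group_vna R [set: braid_inf] =
  [set a *: (idfun : ell2 R braid_inf -> ell2 R braid_inf) | a in [set: R[i]]].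
Proof. exact: relative_icc_irreducible braid_conj_infinite. Qed.
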